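(* Let $\mathbf{2}=\{1,2\}$ with preorder $1\le2$. The structure $\mathcal{X}_{\mathcal{D}(\mathrm{Mem})}=(X,\sqsubseteq,\oplus_1,E_1,\oplus_2,E_2)$ with $\oplus_1=\otimes$, $\oplus_2=\oplus$ and $E_1=E_2=X$ is a $\mathbf{2}$-BI frame.
   Context: Fix a set $\mathrm{Var}$ of variables; values are real numbers. For finite $S\subseteq\mathrm{Var}$, $\mathrm{Mem}[S]$ is the set of maps $S\to\mathbb{R}$, ordered pointwise; $p_A(m)$ is restriction. $\mathcal{D}(Y)$ denotes countably supported probability distributions on $Y$; for $\mu\in\mathcal{D}(\mathrm{Mem}[S])$, $\mathrm{dom}(\mu)=S$ and $\pi_A\mu$ is the marginal on $A$. $X=\bigcup_{S\text{ finite}}\mathcal{D}(\mathrm{Mem}[S])$; $\mu\sqsubseteq\mu'$ iff $\mathrm{dom}(\mu)\subseteq\mathrm{dom}(\mu')$ and $\pi_{\mathrm{dom}(\mu)}\mu'=\mu$. $\mu_1\otimes\mu_2$ is $\emptyset$ if the domains $S,T$ intersect, and otherwise the singleton of $\mu\in\mathcal{D}(\mathrm{Mem}[S\cup T])$ with $\mu(x)=\mu_1(p_Sx)\mu_2(p_Tx)$. A partition is a set of pairwise disjoint nonempty sets; $\mathcal{T}$ coarsens $\mathcal{S}$ if $\bigcup\mathcal{T}=\bigcup\mathcal{S}$ and each element of $\mathcal{T}$ is a union of a subfamily of $\mathcal{S}$. $\mu$ is $\mathcal{S}$-PNA (for a partition $\mathcal{S}$ with $\bigcup\mathcal{S}\subseteq\mathrm{dom}(\mu)$)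 if for every $\mathcal{T}$ coarsening $\mathcal{S}$ and every family $(f_A:\mathrm{Mem}[A]\to[0,\infty))_{A\in\mathcal{T}}$ all non-decreasing or all non-increasing, $\mathbb{E}_{m\sim\mu}[\prod_Af_A(p_Am)]\le\prod_A\mathbb{E}_{m\sim\mu}[f_A(p_Am)]$. $\mu_1\oplus\mu_2$ is empty if the domains $S,T$ intersect, and otherwise the set of $\mu\in\mathcal{D}(\mathrm{Mem}[S\cup T])$ with $\pi_S\mu=\mu_1$, $\pi_T\mu=\mu_2$ that are $(\mathcal{S}\cup\mathcal{T})$-PNA for all partitions $\mathcal{S}$ of a subset of $S$ and $\mathcal{T}$ of a subset of $T$ with $\mu_1$ $\mathcal{S}$-PNA and $\mu_2$ $\mathcal{T}$-PNA. A (down-closed) BI frame $(X,\sqsubseteq,\oplus,E)$ requires: (Down-Closed) $z\in x\oplus y$, $x'\sqsubseteq x$, $y'\sqsubseteq y$ imply some $z'\sqsubseteq z$ with $z'\in x'\oplus y'$; (Commutativity) $z\in x\oplus y\Rightarrow z\in y\oplus x$; (Associativity) $w\in t\oplus z$, $t\in x\oplus y$ imply some $s\in y\oplus z$ with $w\in x\oplus s$; (Unit Existence) each $x$ has $e\in E$ with $x\in e\oplus x$; (Unit Coherence) $e\in E$, $x\in y\oplus e\Rightarrow y\sqsubseteq x$; (Unit Closure) $e\in E$, $e\sqsubseteq e'\Rightarrow e'\in E$. For a preorder $(M,\le)$, an $M$-BI frame is $(X,\sqsubseteq,(\oplus_m),(E_m))$ with each component a BI frame and $m_1\le m_2\Rightarrow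 x\oplus_{m_1}y\subseteq x\oplus_{m_2}y$. *)

(* Defs.v *)
From mathcomp Require Import all_boot all_algebra.
From mathcomp Require Import all_classical all_reals all_analysis.

Set Implicit Arguments.
Unset Strict Implicit.
Unset Printing Implicit Defensive.

Local Open Scope classical_set_scope.
Local Open Scope ring_scope.

Section BIFrame.
Variable X : Type.
Variables (le : X -> X -> Prop) (op : X -> X -> set X) (E : set X).

Definition down_closed := forall x y z x' y', op x y z -> le x' x -> le y' y ->
  exists2 z', le z' z & op x' y' z'.
Definition commutativity := forall x y z, op x y z -> op y x z.
Definition associativity := forall x y z t w, op t z w -> op x y t ->
  exists2 s, op y z s & op x s w.
Definition unit_existence := forall x, exists2 e, E e & op e x x.
Definition unit_coherence := forall e x y, E e -> op y e x -> le y x.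
Definition unit_closure := forall e e', E e -> le e e' -> E e'.

Definition BI_frame : Prop :=
  down_closed /\ commutativity /\ associativity /\ unit_existence /\
  unit_coherence /\ unit_closure.
End BIFrame.

(* (M, leM) is a preorder indexing the family of frames *)
Definition M_BI_frame (M X : Type) (leM : M -> M -> Prop) (le : X -> X -> Prop)
    (op : M -> X -> X -> set X) (E : M -> set X) : Prop :=
  (forall m, BI_frame le (op m) (E m)) /\
  (forall m1 m2 x y, leM m1 m2 -> op m1 x y `<=` op m2 x y).

Inductive two := One | Two.
Definition le_two (a b : two) : Prop := a = b \/ (a = One /\ b = Two).

Section Dist.
Variables (Var : Type) (R : realType).

Definition Mem (S : set Var) := {x : Var | S x} -> R.

Definition mem_le (S : set Var) (m m' : Mem S) : Prop := forall a, m a <= m' a.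

(* restriction p_A : Mem[S] -> Mem[A]; only used when A `<=` S, in which case
   it is the genuine restriction (the default 0 is never used). *)
Definition restr (S A : set Var) (m : Mem S) : Mem A :=
  fun a => match pselect (S (proj1_sig a)) with
           | left h => m (exist _ (proj1_sig a) h)
           | right _ => 0
           end.
Arguments restr {S} A m _.

Record dist := Dist {
  dom : set Var;
  dom_fin : finite_set dom;
  mu : Mem dom -> R;
  mu_ge0 : forall m, 0 <= mu m;
  mu_countable : countable [set m | mu m != 0];
  mu_sum1 : (\esum_(m in [set: Mem dom]) (mu m)%:E = 1)%E }.
Arguments mu : clear implicits.

(* expectation of a [0,+oo]-valued function *)
Definition expect (d : dist) (g : Mem (dom d) -> \bar R) : \bar R :=
  (\esum_(m in [set: Mem (dom d)]) ((mu d m)%:E * g m))%E.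
Arguments expect : clear implicits.

(* marginal pi_A d (for A `<=` dom d) *)
Definition marg (d : dist) (A : set Var) (m : Mem A) : \bar R :=
  \esum_(x in [set x : Mem (dom d) | restr A x = m]) (mu d x)%:E.
Arguments marg : clear implicits.

Definition le_dist (d d' : dist) : Prop :=
  dom d `<=` dom d' /\ forall m, marg d' (dom d) m = (mu d m)%:E.

Definition partition (P : set (set Var)) : Prop :=
  (forall A, P A -> A !=set0) /\
  (forall A B, P A -> P B -> A <> B -> A `&` B = set0).

(* T coarsens S (a coarsening of a partition is itself a partition) *)
Definition coarsens (T S : set (set Var)) : Prop :=
  [/\ partition T,
      \bigcup_(A in T) A = \bigcup_(A in S) A &
      forall B, T B -> exists2 F, F `<=` S & B = \bigcup_(A in F) A].

Definition nondecr (A : set Var) (f : Mem A -> R) : Prop :=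
  forall m m', mem_le m m' -> f m <= f m'.
Definition nonincr (A : set Var) (f : Mem A -> R) : Prop :=
  forall m m', mem_le m m' -> f m' <= f m.

Definition PNA (P : set (set Var)) (d : dist) : Prop :=
  \bigcup_(A in P) A `<=` dom d /\
  forall T, coarsens T P ->
  forall f : forall A : set Var, Mem A -> R,
    (forall A, T A -> forall m, 0 <= f A m) ->
    ((forall A, T A -> nondecr (f A)) \/ (forall A, T A -> nonincr (f A))) ->
    (expect d (fun m => \big[*%E/1%E]_(A \in T) (f A (restr A m))%:E)
     <= \big[*%E/1%E]_(A \in T) expect d (fun m => (f A (restr A m))%:E))%E.

Definition tensor (d1 d2 : dist) : set dist :=
  [set d | [/\ dom d1 `&` dom d2 = set0,
               dom d = dom d1 `|` dom d2 &
               forall m, mu d m = mu d1 (restr (dom d1) m) * mu d2 (restr (dom d2) m)]].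

Definition oplus (d1 d2 : dist) : set dist :=
  [set d | [/\ dom d1 `&` dom d2 = set0,
               dom d = dom d1 `|` dom d2,
               (forall m, marg d (dom d1) m = (mu d1 m)%:E),
               (forall m, marg d (dom d2) m = (mu d2 m)%:E) &
               forall P Q, partition P -> partition Q ->
                 \bigcup_(A in P) A `<=` dom d1 -> \bigcup_(A in Q) A `<=` dom d2 ->
                 PNA P d1 -> PNA Q d2 -> PNA (P `|` Q) d]].

Definition frame_op (i : two) : dist -> dist -> set dist :=
  match i with One => tensor | Two => oplus end.

End Dist.

(* Main.v *)
(** Whether [mu] is PNA for [P] depends only on the marginal of [mu] on the
    variables of [P]; hence marginals of [z] (resp. [w]) witness Down-Closed
    and Associativity.  For the associativity of [oplus], the blocks of a
    partition of [dom y `|` dom z] are split into their traces on both domains: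
    PNA passes to traces (test functions may ignore variables) and back to
    coarsenings.  Finally [tensor] is included in [oplus] by integrating one
    factor at a time: for fixed [m1] the sections of the test functions are
    monotone in [m2], and their [mu2]-averages are monotone in [m1].  The
    averages must be finite to serve as test functions, so this is done for
    truncated functions first. *)
Require Import Defs.
From mathcomp Require Import all_boot all_order all_algebra.
From mathcomp Require Import finmap.
From mathcomp Require Import all_classical all_reals all_analysis.
Local Open Scope classical_set_scope.

Set Implicit Arguments.
Unset Strict Implicit.
Unset Printing Implicit Defensive.
Import Order.TTheory GRing.Theory Num.Theory.
Local Open Scope ring_scope.

(** * Sums of non-negative extended reals *)

Lemma esumZl (R : realType) (T : choiceType) (S : set T) (r : R) (a : T -> \bar R) :
  0 <= r -> (forall i, 0 <= a i)%E ->
  (\esum_(i in S) (r%:E * a i) = r%:E * \esum_(i in S) a i)%E.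
Proof.
move=> r0 a0; rewrite /esum -ereal_supZl//; last first.
  by apply/set0P; exists (\sum_(x \in set0) a x); exists set0 => //; exact: fsets_set0.
congr ereal_sup; apply/seteqP; split=> [_ [X SX <-]|_ [_ [X SX <-] <-]].
  exists (\sum_(x \in X) a x); first by exists X.
  by rewrite ge0_mule_fsumr.
by exists X => //; rewrite ge0_mule_fsumr.
Qed.

(** Tonelli along the graph of [f]: the pairs [(f x, x)] are exactly the index set of the iterated
    sum. *)
Lemma esum_fibers (R : realType) (T U : choiceType) (f : T -> U) (a : T -> \bar R) :
  (forall x, 0 <= a x)%E ->
  \esum_(x in [set: T]) a x =
  \esum_(y in [set: U]) \esum_(x in [set x | f x = y]) a x.
Proof.
move=> a0; rewrite esum_esum//.
rewrite (reindex_esum [set: T] _ (fun x => (f x, x)))//; split=> //=.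
  by move=> x y _ _ [].
by move=> [y x] [_ /= <-]; exists x.
Qed.

Section Distributions.
Variables (Var : Type) (R : realType).
Notation Mem := (@Defs.Mem Var R).
Notation dist := (dist Var R).
Notation restr A m := (@Defs.restr Var R _ A m).
Notation expect d := (@Defs.expect Var R d).
Implicit Types (S A B D Y : set Var) (P Q T : set (set Var)) (d e : dist).

(** * Restriction of memories *)

Lemma restrE S A (m : Mem S) (a : {x | A x}) (h : S (sval a)) :
  restr A m a = m (exist _ (sval a) h).
Proof.
rewrite /Defs.restr; case: pselect => // h'.
by congr (m (exist _ _ _)); exact: Prop_irrelevance.
Qed.

Lemma restr_out S A (m : Mem S) (a : {x | A x}) :
  ~ S (sval a) -> restr A m a = 0.
Proof. by rewrite /Defs.restr; case: pselect. Qed.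

Lemma restr_id S (m : Mem S) : restr S m = m.
Proof. by apply/funext => -[a Sa]; rewrite (restrE _ (a := exist _ a Sa) Sa). Qed.

Lemma restr_restr S B A (m : Mem S) :
  A `<=` B -> restr A (restr B m) = restr A m.
Proof.
move=> AB; apply/funext => a; rewrite (restrE _ (AB _ (proj2_sig a))).
(* Off [S] both sides take the default value 0. *)
have [Sa|Sa] := pselect (S (sval a)); last by rewrite !restr_out.
by rewrite (restrE _ (a := a) Sa) (restrE _ (a := exist _ _ _) Sa).
Qed.

Lemma restr_agree S A (m : Mem S) (m' : Mem S) :
  (forall a : {x | S x}, A (sval a) -> m a = m' a) -> restr A m = restr A m'.
Proof.
move=> mm'; apply/funext => a.
have [Sa|Sa] := pselect (S (sval a)); last by rewrite !restr_out.
by rewrite !(restrE _ Sa) mm'//; exact: (proj2_sig a).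
Qed.

Lemma restr_le S A (m m' : Mem S) : mem_le m m' -> mem_le (restr A m) (restr A m').
Proof.
move=> mm' a; have [Sa|Sa] := pselect (S (sval a)); last by rewrite !restr_out.
by rewrite !(restrE _ Sa).
Qed.

(** * Expectations *)

Lemma le_expect d (F G : Mem (dom d) -> \bar R) :
  (forall m, F m <= G m)%E -> (expect _ F <= expect _ G)%E.
Proof.
move=> FG; apply: le_esum => m _; apply: lee_wpmul2l => //.
by rewrite lee_fin mu_ge0.
Qed.

Lemma eq_expect d (F G : Mem (dom d) -> \bar R) : F =1 G -> expect _ F = expect _ G.
Proof. by move=> /funext ->. Qed.

Lemma expect_ge0 d (F : Mem (dom d) -> \bar R) :
  (forall m, 0 <= F m)%E -> (0 <= expect _ F)%E.
Proof.
by move=> F0; apply: esum_ge0 => m _; rewrite mule_ge0// lee_fin mu_ge0.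
Qed.

Lemma expectZl d (r : R) (F : Mem (dom d) -> \bar R) :
  0 <= r -> (forall m, 0 <= F m)%E ->
  expect _ (fun m => r%:E * F m)%E = (r%:E * expect _ F)%E.
Proof.
move=> r0 F0; rewrite /Defs.expect -esumZl//.
  by apply: eq_esum => m _; rewrite muleCA.
by move=> m; rewrite mule_ge0// lee_fin mu_ge0.
Qed.

Lemma expect_cst d (r : R) : 0 <= r -> expect d (fun=> r%:E) = r%:E.
Proof.
move=> r0; rewrite -[RHS]mule1 -(mu_sum1 d) -esumZl//.
  by apply: eq_esum => m _; rewrite muleC.
by move=> m; rewrite lee_fin mu_ge0.
Qed.

(** * Marginals and the extension order *)

(** In this form marginals fall under the lemmas about expectations. *)
Lemma margE d A (m : Mem A) :
  marg d m = expect _ (fun x : Mem (dom d) => (restr A x == m)%:R%:E).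
Proof.
rewrite /marg esum_mkcond; apply: eq_esum => x _.
case: ifPn; rewrite ?inE ?notin_setE/= => /eqP; first by move=> ->; rewrite mule1.
by move=> /negbTE ->; rewrite mule0.
Qed.

Lemma marg_id d (m : Mem (dom d)) : marg d m = (mu m)%:E.
Proof.
rewrite /marg [X in esum X _](_ : _ = [set m]); last first.
  by apply/seteqP; split => x /=; rewrite restr_id.
by rewrite esum_set1// lee_fin mu_ge0.
Qed.

(** Change of variables: the sum is grouped by the fibres of the restriction to [A], on each of
    which the integrand is constant. *)
Lemma expect_marg d (A : set Var) (p : Mem A -> R) (F : Mem A -> R) :
  (forall m, 0 <= F m) -> (forall m, marg d m = (p m)%:E) ->
  expect _ (fun x : Mem (dom d) => (F (restr A x))%:E)
  = (\esum_(m in [set: Mem A]) ((p m)%:E * (F m)%:E))%E.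
Proof.
move=> F0 dp; rewrite /Defs.expect.
rewrite (esum_fibers (fun x : Mem (dom d) => restr A x)); last first.
  by move=> x; rewrite mule_ge0// lee_fin ?mu_ge0.
apply: eq_esum => m _; rewrite -dp muleC /marg -esumZl//.
  by apply: eq_esum => x /= ->; rewrite muleC.
by move=> x; rewrite lee_fin mu_ge0.
Qed.

Lemma expect_le_dist d e (F : Mem (dom e) -> R) :
  (forall m, 0 <= F m) -> le_dist e d ->
  expect _ (fun x : Mem (dom d) => (F (restr (dom e) x))%:E)
  = expect _ (fun m : Mem (dom e) => (F m)%:E).
Proof. by move=> F0 [_ ed]; exact: expect_marg. Qed.

(** Marginalising in two stages: the change of variables is applied to the indicator of
    [restr A x = m]. *)
Lemma marg_le_dist d e A (m : Mem A) :
  le_dist e d -> A `<=` dom e -> marg e m = marg d m.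
Proof.
move=> ed Ae; rewrite !margE.
rewrite -(expect_le_dist (F := fun x => (restr A x == m)%:R) _ ed) => [|x]; last exact: ler0n.
by apply: eq_expect => x; rewrite restr_restr.
Qed.

Lemma marg_ge0 d A (m : Mem A) : (0 <= marg d m)%E.
Proof. by apply: esum_ge0 => x _; rewrite lee_fin mu_ge0. Qed.

Lemma marg_fin d A (m : Mem A) : marg d m \is a fin_num.
Proof.
rewrite ge0_fin_numE ?marg_ge0// margE.
apply: (@le_lt_trans _ _ 1%E); last exact: ltry.
rewrite -[leRHS](@expect_cst d 1)//; apply: le_expect => x.
by rewrite lee_fin lern1; case: (_ == _).
Qed.

Section Marginal.
Variables (d : dist) (A : set Var) (Ad : A `<=` dom d).

Definition marginal_mu (m : Mem A) : R := fine (marg d m).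

Lemma marginal_mu_ge0 m : 0 <= marginal_mu m.
Proof. by rewrite fine_ge0// marg_ge0. Qed.

Lemma marginal_muE m : (marginal_mu m)%:E = marg d m.
Proof. by rewrite fineK// marg_fin. Qed.

(** The support lies in the image of the support of [d] under restriction. *)
Lemma marginal_countable : countable [set m | marginal_mu m != 0].
Proof.
apply: (@sub_countable _ _ _ ((fun x : Mem (dom d) => restr A x) @` [set x | mu x != 0])).
  apply: subset_card_le => m /= mu0; apply: contrapT => nm.
  move/eqP : mu0; apply; rewrite /marginal_mu /marg esum1// => x /= xm.
  congr EFin; apply: contrapT => /eqP mux; apply: nm; exists x => //.
exact: (sub_countable (card_image_le _ _) (mu_countable d)).
Qed.

(** Change of variables with test function 1. *)
Lemma marginal_sum1 : (\esum_(m in [set: Mem A]) (marginal_mu m)%:E = 1)%E.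
Proof.
have := @expect_marg d A marginal_mu (fun=> 1) (fun=> ler01)
  (fun m => esym (marginal_muE m)).
rewrite expect_cst// => ->.
by apply: eq_esum => m _; rewrite mule1.
Qed.

Definition marginal : dist :=
  Dist (sub_finite_set Ad (@dom_fin _ _ d)) marginal_mu_ge0 marginal_countable
    marginal_sum1.

Lemma marginal_le : le_dist marginal d.
Proof. by split => // m; rewrite -marginal_muE. Qed.

End Marginal.

Lemma le_dist_trans d1 d2 d3 : le_dist d1 d2 -> le_dist d2 d3 -> le_dist d1 d3.
Proof.
move=> [s12 m12] d23; split; first exact: subset_trans s12 d23.1.
by move=> m; rewrite -(marg_le_dist m d23 s12).
Qed.

Lemma le_dist_common e1 e2 d : le_dist e1 d -> le_dist e2 d ->
  dom e1 `<=` dom e2 -> le_dist e1 e2.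
Proof.
move=> [_ m1] e2d s12; split => // m.
by rewrite (marg_le_dist m e2d s12).
Qed.

(** * Gluing memories on disjoint domains *)

(* [restr] extends a memory by 0, so on disjoint domains a pointwise sum glues
   two memories together. *)
Definition glue D S1 S2 (m1 : Mem S1) (m2 : Mem S2) : Mem D :=
  fun a => restr D m1 a + restr D m2 a.
Arguments glue D {S1 S2} m1 m2 _.

Lemma glue_l S1 S2 D (m1 : Mem S1) (m2 : Mem S2) : S1 `&` S2 = set0 ->
  S1 `<=` D -> restr S1 (glue D m1 m2) = m1.
Proof.
move=> S12 S1D; apply/funext => -[a S1a]; rewrite (restrE _ (a := exist _ _ _) (S1D _ S1a)) /glue/=.
rewrite (restrE _ (a := exist _ _ _) S1a) (restr_out _ (a := exist _ _ _)) ?addr0//.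
by move=> /= S2a; have : (S1 `&` S2) a by []; rewrite S12.
Qed.

Lemma glueC S1 S2 D (m1 : Mem S1) (m2 : Mem S2) : glue D m1 m2 = glue D m2 m1.
Proof. by apply/funext => a; rewrite /glue addrC. Qed.

Lemma glue_r S1 S2 D (m1 : Mem S1) (m2 : Mem S2) : S1 `&` S2 = set0 ->
  S2 `<=` D -> restr S2 (glue D m1 m2) = m2.
Proof. by move=> S12 S2D; rewrite glueC glue_l// setIC. Qed.

Lemma glue_restr S1 S2 D (m : Mem D) : S1 `&` S2 = set0 -> D = S1 `|` S2 ->
  glue D (restr S1 m) (restr S2 m) = m.
Proof.
move=> S12 DE; apply/funext => -[a Da]; rewrite /glue.
have : (S1 `|` S2) a by rewrite -DE.
have nS12 : S1 a -> S2 a -> False.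
  by move=> S1a S2a; have : (S1 `&` S2) a by []; rewrite S12.
move=> [Sa|Sa].
  rewrite (restrE _ (a := exist _ _ _) Sa) (restrE _ (a := exist _ _ _) Da).
  by rewrite (restr_out _ (a := exist _ _ _)) ?addr0//=; exact: nS12.
rewrite addrC (restrE _ (a := exist _ _ _) Sa) (restrE _ (a := exist _ _ _) Da).
by rewrite (restr_out _ (a := exist _ _ _)) ?addr0//= => /nS12; exact.
Qed.

Lemma glue_le S1 S2 D (m1 m1' : Mem S1) (m2 m2' : Mem S2) :
  mem_le m1 m1' -> mem_le m2 m2' -> mem_le (glue D m1 m2) (glue D m1' m2').
Proof. by move=> m1m2 m2m2' a; rewrite lerD// restr_le. Qed.

(** * The independent product and its frame laws *)

Lemma tensorC d1 d2 d : tensor d1 d2 d -> tensor d2 d1 d.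
Proof.
move=> [S12 dE muE]; split; [by rewrite setIC|by rewrite setUC|].
by move=> m; rewrite muE mulrC.
Qed.

(** Tonelli: memories of [d] correspond to pairs of memories of [d1] and [d2], by restriction one
    way and by [glue] the other. *)
Lemma expect_tensor d1 d2 d (F : Mem (dom d) -> \bar R) : tensor d1 d2 d ->
  (forall m, 0 <= F m)%E ->
  expect _ F = expect d1 (fun m1 => expect d2 (fun m2 => F (glue (dom d) m1 m2))).
Proof.
move=> [S12 dE muE] F0; rewrite /Defs.expect.
have S1 : dom d1 `<=` dom d by rewrite dE; exact: subsetUl.
have S2 : dom d2 `<=` dom d by rewrite dE; exact: subsetUr.
pose a (m1 : Mem (dom d1)) (m2 : Mem (dom d2)) :=
  ((mu m1)%:E * ((mu m2)%:E * F (glue (dom d) m1 m2)))%E.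
have a0 m1 m2 : (0 <= a m1 m2)%E by rewrite !mule_ge0// lee_fin mu_ge0.
transitivity (\esum_(m1 in [set: Mem (dom d1)])
    \esum_(m2 in [set: Mem (dom d2)]) a m1 m2); last first.
  apply: eq_esum => m1 _; rewrite -esumZl ?mu_ge0// => m2.
  by rewrite mule_ge0// lee_fin mu_ge0.
rewrite esum_esum// (reindex_esum [set: Mem (dom d)] _
  (fun m => (restr (dom d1) m, restr (dom d2) m))).
  by apply: eq_esum => m _; rewrite /a/= glue_restr// muleA muE EFinM.
split=> //=.
- by move=> m m' _ _ [e1 e2]; rewrite -(glue_restr m S12 dE) e1 e2 glue_restr.
- move=> [m1 m2] _ /=; exists (glue (dom d) m1 m2) => //.
  by rewrite glue_l// glue_r.
Qed.

(** After Tonelli the indicator of [restr A x = m] factors into indicators on [A1] and [A2], each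
    seeing one factor only. *)
Lemma marg_tensor d1 d2 d A1 A2 A (m : Mem A) : tensor d1 d2 d ->
  A1 `<=` dom d1 -> A2 `<=` dom d2 -> A = A1 `|` A2 ->
  marg d m = (marg d1 (restr A1 m) * marg d2 (restr A2 m))%E.
Proof.
move=> t12 A1d A2d AE; have [S12 dE _] := t12.
have A12 : A1 `&` A2 = set0.
  by rewrite -subset0 -S12; exact: setISS.
have A1A : A1 `<=` A by rewrite AE; exact: subsetUl.
have A2A : A2 `<=` A by rewrite AE; exact: subsetUr.
have S1 : dom d1 `<=` dom d by rewrite dE; exact: subsetUl.
have S2 : dom d2 `<=` dom d by rewrite dE; exact: subsetUr.
rewrite margE (expect_tensor t12); last by move=> x; rewrite lee_fin ler0n.
(* [expectZl] pulls out only real scalars, hence the passage through [fine]. *)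
rewrite -(fineK (marg_fin d2 _)) muleC [marg d1 _]margE -expectZl; last 2 first.
- by rewrite fine_ge0// marg_ge0.
- by move=> x; rewrite lee_fin ler0n.
apply: eq_expect => m1; rewrite (fineK (marg_fin d2 _)) muleC margE -expectZl; last 2 first.
- by rewrite ler0n.
- by move=> x; rewrite lee_fin ler0n.
apply: eq_expect => m2; rewrite -EFinM -natrM mulnb; congr (_%:R%:E).
have g1 : restr A1 (glue (dom d) m1 m2) = restr A1 m1.
  by rewrite -[in RHS](glue_l m1 m2 S12 S1) restr_restr.
have g2 : restr A2 (glue (dom d) m1 m2) = restr A2 m2.
  by rewrite -[in RHS](glue_r m1 m2 S12 S2) restr_restr.
congr nat_of_bool; apply/eqP/andP => [<-|[/eqP e1 /eqP e2]].
  by split; apply/eqP; rewrite restr_restr// ?g1 ?g2.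
rewrite -(glue_restr m A12 AE) -e1 -e2 -[LHS](glue_restr _ A12 AE) !restr_restr//.
by rewrite g1 g2.
Qed.

(** [Mem set0] has a single element, so this is the total mass. *)
Lemma marg_set0 d (m : Mem set0) : marg d m = 1%E.
Proof.
rewrite margE -[RHS](@expect_cst d 1)//; apply: eq_expect => x.
by rewrite (_ : restr set0 x = m) ?eqxx//; apply/funext => -[].
Qed.

Lemma tensor_le_l d1 d2 d : tensor d1 d2 d -> le_dist d1 d.
Proof.
move=> t12; have [_ dE _] := t12; split; first by rewrite dE; exact: subsetUl.
move=> m; rewrite (marg_tensor _ t12 (A1 := dom d1) (A2 := set0)) ?setU0//.
by rewrite restr_id marg_id marg_set0 mule1.
Qed.

Lemma tensor_le_r d1 d2 d : tensor d1 d2 d -> le_dist d2 d.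
Proof. by move=> /tensorC; exact: tensor_le_l. Qed.

Lemma tensor_down_closed : down_closed (@le_dist Var R) (@tensor Var R).
Proof.
move=> x y z x' y' txy x'x y'y; have [S12 zE _] := txy.
have xyz : dom x' `|` dom y' `<=` dom z.
  by rewrite zE; apply: setUSS; [exact: x'x.1|exact: y'y.1].
exists (marginal xyz); first exact: marginal_le.
split=> //; first by rewrite -subset0 -S12; exact: setISS x'x.1 y'y.1.
move=> m; apply: EFin_inj; rewrite marginal_muE EFinM.
(* The marginal factors into those of [x] on [dom x'] and of [y] on [dom y'], which are [x'] and
   [y']. *)
rewrite (marg_tensor _ txy x'x.1 y'y.1 erefl).
by rewrite -(marg_le_dist _ x'x (@subset_refl _ _)) -(marg_le_dist _ y'y (@subset_refl _ _)) !marg_id.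
Qed.

Lemma tensor_associative : associativity (@tensor Var R).
Proof.
move=> x y z t w ttz txy; have [tz0 wE wmu] := ttz; have [xy0 tE tmu] := txy.
have yt : dom y `<=` dom t by rewrite tE; exact: subsetUr.
have xt : dom x `<=` dom t by rewrite tE; exact: subsetUl.
have yzw : dom y `|` dom z `<=` dom w by rewrite wE; exact: setSU.
have muE m : mu (d := marginal yzw) m = mu (restr (dom y) m) * mu (restr (dom z) m).
  apply: EFin_inj; rewrite marginal_muE EFinM.
  (* The marginal of [w] factors into that of [t] on [dom y], which is [y], and [z] itself. *)
  rewrite (marg_tensor _ ttz yt (@subset_refl _ _) erefl) marg_id; congr (_ * _)%E.
  by have [_ ->] := tensor_le_r txy.
exists (marginal yzw).
  by split=> //; rewrite -subset0 -tz0; exact: setSI.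
split=> [||m].
- by rewrite setIUr xy0 set0U -subset0 -tz0; exact: setSI.
- by rewrite wE tE setUA.
- rewrite wmu tmu muE -mulrA !restr_restr//.
  + exact: subsetUr.
  + exact: subsetUl.
Qed.

(** * Partitions, coarsenings and PNA *)

(** Sending a variable to its block reaches every block, as blocks are non-empty; uncovered
    variables go to the default [set0]. *)
Lemma partition_finite T D : Defs.partition T -> finite_set D ->
  \bigcup_(A in T) A `<=` D -> finite_set T.
Proof.
move=> [T0 Tdisj] finD TD.
apply: (@sub_finite_set _ _ ((fun v => xget set0 [set A | T A /\ A v]) @` D)).
  move=> A TA; have [v Av] := T0 _ TA.
  exists v; first by apply: TD; exists A.
  apply: xget_unique => // B [TB Bv]; apply: contrapT => BA.
  by have : (B `&` A) v by []; rewrite Tdisj.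
exact: finite_image.
Qed.

Lemma prodEFin_fsbig T (F : set Var -> R) : finite_set T ->
  (\big[*%E/1%E]_(A \in T) (F A)%:E = (\prod_(A <- fset_set T) F A)%:E)%E.
Proof. by move=> finT; rewrite fsbig_finite//= prodEFin. Qed.

(** The test functions of every coarsening read only variables of [dom e], so both sides of the
    inequality are the same under [d] and [e]. *)
Lemma PNA_le_dist P d e : le_dist e d -> \bigcup_(A in P) A `<=` dom e ->
  PNA P e <-> PNA P d.
Proof.
move=> ed Pe; have Pd := subset_trans Pe ed.1.
suff E T (f : forall A, Mem A -> R) : coarsens T P ->
    (forall A, T A -> forall m, 0 <= f A m) ->
    expect d (fun m => \big[*%E/1%E]_(A \in T) (f A (restr A m))%:E)%E =
    expect e (fun m => \big[*%E/1%E]_(A \in T) (f A (restr A m))%:E)%E /\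
    (\big[*%E/1%E]_(A \in T) expect d (fun m => (f A (restr A m))%:E) =
    \big[*%E/1%E]_(A \in T) expect e (fun m => (f A (restr A m))%:E))%E.
  split=> -[_ pna]; split=> // T TP f f0 fm; have [E1 E2] := E T f TP f0.
    by rewrite E1 E2; exact: pna.
  by rewrite -E1 -E2; exact: pna.
move=> [Tpart TP _] f0; have finT : finite_set T.
  by apply: (partition_finite Tpart (@dom_fin _ _ e)); rewrite TP.
have Te A : T A -> A `<=` dom e.
  by move=> TA v Av; apply: Pe; rewrite -TP; exists A.
split.
  under eq_expect do rewrite prodEFin_fsbig//.
  under [RHS]eq_expect do rewrite prodEFin_fsbig//.
  rewrite -(expect_le_dist (F := fun m => \prod_(A <- fset_set T) f A (restr A m)) _ ed).
    apply: eq_expect => m; congr EFin; rewrite big_seq [RHS]big_seq.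
    apply: eq_bigr => A; rewrite in_fset_set// inE => TA.
    by rewrite restr_restr//; exact: Te.
  move=> m; rewrite big_seq; apply: prodr_ge0 => A.
  by rewrite in_fset_set// inE => /f0.
apply: eq_fsbigr => A; rewrite inE => TA.
rewrite -(expect_le_dist (F := fun m => f A (restr A m)) (fun m => f0 _ TA _) ed).
by apply: eq_expect => m; rewrite restr_restr//; exact: Te.
Qed.

Lemma coarsens_trans P Q T : coarsens T Q -> coarsens Q P -> coarsens T P.
Proof.
move=> [Tp TQ Tsub] [_ QP Qsub]; split => //; first by rewrite TQ.
move=> B TB; have [F FQ BE] := Tsub _ TB.
(* Every point of [B] lies in a block of [Q] inside [B], hence in a block of [P] inside [B]. *)
exists [set A | P A /\ A `<=` B]; first by move=> A [].
apply/seteqP; split=> [v|v [A [_ AB]]]; last exact: AB.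
rewrite BE => -[C FC Cv]; have [G GP CE] := Qsub _ (FQ _ FC).
move: (Cv); rewrite CE => -[A GA Av]; exists A => //; split; first exact: GP.
by move=> u Au; exists C => //; rewrite CE; exists A.
Qed.

Lemma PNA_coarsens P Q d : coarsens Q P -> PNA P d -> PNA Q d.
Proof.
move=> QP [Pd pna]; split; first by have [_ -> _] := QP.
by move=> T TQ; apply: pna; exact: coarsens_trans TQ QP.
Qed.

(** * PNA through block colourings *)

(* Block colourings [c] replace coarsenings: the colour class of [i] is a block
   of the coarsening, with the classes that happen to be empty allowed. *)
Definition colour_class P (I : choiceType) (c : set Var -> I) (i : I) : set Var :=
  \bigcup_(B in [set B | P B /\ c B = i]) B.

Definition depends_on S D (h : Mem S -> R) := forall m m' : Mem S,
  (forall a, D (sval a) -> m a = m' a) -> h m = h m'.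

(** For partitions inside [dom d] this is equivalent to [PNA]. Test functions live on all of
    [Mem (dom d)], so taking traces or fixing some variables keeps the format. *)
Definition coloured_PNA P d := forall (I : choiceType) (s : seq I)
    (c : set Var -> I) (h : I -> Mem (dom d) -> R),
  uniq s -> (forall i m, 0 <= h i m) ->
  (forall i, depends_on (colour_class P c i) (h i)) ->
  (forall i, nondecr (h i)) \/ (forall i, nonincr (h i)) ->
  (expect d (fun m => (\prod_(i <- s) h i m)%:E)
    <= \prod_(i <- s) expect d (fun m => (h i m)%:E))%E.

(** A block of [P] is coloured by the block of the coarsening [T] that contains it. *)
Lemma coloured_PNA_PNA P d : Defs.partition P -> \bigcup_(A in P) A `<=` dom d ->
  coloured_PNA P d -> PNA P d.
Proof.
move=> Pp Pd pna; split => // T [Tp TP Tsub] f f0 fm.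
have finT : finite_set T.
  by apply: (partition_finite Tp (@dom_fin _ _ d)); rewrite TP.
pose c B := xget set0 [set A | T A /\ B `<=` A].
(* Colours range over all sets; off [T] the constant 1 meets every requirement. *)
pose h A (m : Mem (dom d)) := if A \in T then f A (restr A m) else 1.
have hE A : A \in fset_set T -> h A = fun m => f A (restr A m).
  by rewrite in_fset_set// => TA; rewrite /h TA.
have -> : expect d (fun m => \big[*%E/1%E]_(A \in T) (f A (restr A m))%:E)%E =
    expect d (fun m => (\prod_(A <- fset_set T) h A m)%:E).
  apply: eq_expect => m; rewrite prodEFin_fsbig//; congr EFin.
  by apply: eq_big_seq => A /hE ->.
have -> : (\big[*%E/1%E]_(A \in T) expect d (fun m => (f A (restr A m))%:E) =
    \prod_(A <- fset_set T) expect d (fun m => (h A m)%:E))%E.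
  by rewrite fsbig_finite//=; apply: eq_big_seq => A /hE ->.
apply: (pna _ _ c) => //.
- by move=> A m; rewrite /h; case: ifPn => //; rewrite inE => /f0.
- move=> A m m' mm'; rewrite /h; case: ifPn => //; rewrite inE => TA.
  congr (f A _); apply: restr_agree => a Aa; apply: mm'.
  have [F FP AE] := Tsub _ TA.
  move: (Aa); rewrite {1}AE => -[B FB Ba]; exists B => //; split; first exact: FP.
  have BA : B `<=` A by move=> v Bv; rewrite AE; exists B.
  (* Another block of [T] containing [B] would meet [A] at the variable [a]. *)
  apply: xget_unique => // A' [TA' BA']; apply: contrapT => A'A.
  have : (A' `&` A) (sval a) by split=> //; exact: BA'.
  by have [_ Td] := Tp; rewrite Td.
- case: fm => fm; [left|right] => A m m' mm'; rewrite /h; case: ifPn => //;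
  rewrite inE => TA; by apply: fm => //; exact: restr_le.
Qed.

(** Meant for a duplicate-free list of colours, where a non-empty class determines its colour. *)
Lemma filter_atmost1 (I : eqType) (p : pred I) (s : seq I) : uniq s ->
  (forall i j, p i -> p j -> i = j) ->
  [seq i <- s | p i] = [::] \/ exists i, [seq i <- s | p i] = [:: i].
Proof.
move=> us pp; have := filter_uniq p us; have := filter_all p s.
case: [seq i <- s | p i] => [|i [|j r]]; [by left|by right; exists i|].
by rewrite /= => /and3P[pi pj _]; rewrite (pp _ _ pi pj) inE eqxx.
Qed.

(** The non-empty colour classes form a coarsening [T] of [P]. A function whose class is empty is
    constant and factors out of both sides. *)
Lemma PNA_coloured_PNA P d : Defs.partition P -> PNA P d -> coloured_PNA P d.
Proof.
move=> [P0 Pdisj] [Pd pna] I s c h us h0 hd hm.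
pose U := colour_class P c.
have Uinj i j v : U i v -> U j v -> i = j.
  move=> [B [PB <-] Bv] [C [PC <-] Cv]; congr c; apply: contrapT => BC.
  by have : (B `&` C) v by []; rewrite Pdisj.
pose T := [set U i | i in [set i | U i !=set0]].
have UP i : U i `<=` \bigcup_(A in P) A by move=> v [B [PB _] Bv]; exists B.
have TP : coarsens T P.
  split; first split.
  - by move=> _ [i U0 <-].
  - move=> _ _ [i Ui <-] [j Uj <-] ij; rewrite -subset0 => v [vi vj].
    by apply: ij; congr U; exact: Uinj vi vj.
  - apply/seteqP; split=> v [A]; first by move=> [i _ <-] /UP.
    move=> PA Av; exists (U (c A)); last by exists A.
    by exists (c A) => //; exists v; exists A.
  - by move=> _ [i _ <-]; exists [set B | P B /\ c B = i] => // B [].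
have finT : finite_set T.
  have [Tp TE _] := TP.
  by apply: (partition_finite Tp (@dom_fin _ _ d)); rewrite TE.
(* For a class [A] in [T] there is at most one factor, and the value is 1 if its colour is not
   listed. Padding by 0 is harmless, as [h i] reads only its class. *)
pose f A (m : Mem A) := \prod_(i <- s | U i == A) h i (restr (dom d) m).
have fE A (m : Mem (dom d)) : A `<=` dom d ->
    f A (restr A m) = \prod_(i <- s | U i == A) h i m.
  move=> Ad; apply: eq_bigr => i /eqP UA; apply: hd => a; rewrite -/U UA => Aa.
  by rewrite (restrE _ Aa) (restrE _ (a := exist _ _ _) (proj2_sig a)); case: a Aa.
have Td A : T A -> A `<=` dom d.
  by move=> [i _ <-]; apply: subset_trans Pd; exact: UP.
have T1 A : T A -> [seq i <- s | U i == A] = [::] \/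
    exists i, [seq i <- s | U i == A] = [:: i].
  move=> [k [v Uv] UA]; apply: filter_atmost1 => // i j /eqP Ui /eqP Uj.
  by apply: (Uinj _ _ v); rewrite ?Ui ?Uj -UA.
(* The product of the constant functions, evaluated at the zero memory. *)
pose k := \prod_(i <- s | ~~ (U i \in T)) h i (fun=> 0).
have k0 : 0 <= k by apply: prodr_ge0.
have hcst i m : ~~ (U i \in T) -> h i m = h i (fun=> 0).
  rewrite notin_setE => TU; apply: hd => a Ua; exfalso; apply: TU.
  by exists i => //; exists (sval a).
(* Each listed colour with a non-empty class is counted once, at [A = U i]. *)
have exch (F : I -> \bar R) :
    (\prod_(A <- fset_set T) \prod_(i <- s | U i == A) F i =
    \prod_(i <- s | U i \in T) F i)%E.
  rewrite big_seq (exchange_big_dep (fun i => U i \in T))/=; last first.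
    by move=> A i; rewrite in_fset_set// => + /eqP ->.
  apply: eq_bigr => i UiT; rewrite -big_seq_cond; under eq_bigl do rewrite eq_sym.
  by apply: (fbig_pred1_inj (k := id) (f := fun=> F i)); rewrite ?in_fset_set.
have f0 A : T A -> forall m, 0 <= f A m by move=> _ m; exact: prodr_ge0.
have fm : (forall A, T A -> nondecr (f A)) \/ (forall A, T A -> nonincr (f A)).
  case: hm => hm; [left|right] => A _ m m' mm'; apply: ler_prod => i _;
  by rewrite h0 hm//; exact: restr_le.
have := pna T TP f f0 fm.
have -> : expect d (fun m => \big[*%E/1%E]_(A \in T) (f A (restr A m))%:E)%E =
    expect d (fun m => (\prod_(i <- s | U i \in T) h i m)%:E).
  apply: eq_expect => m; rewrite fsbig_finite//= -prodEFin -exch.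
  apply: eq_big_seq => A; rewrite in_fset_set// inE => TA.
  by rewrite fE ?prodEFin//; exact: Td.
have -> : (\big[*%E/1%E]_(A \in T) expect d (fun m => (f A (restr A m))%:E) =
    \prod_(i <- s | U i \in T) expect d (fun m => (h i m)%:E))%E.
  rewrite fsbig_finite//= -exch; apply: eq_big_seq => A.
  rewrite in_fset_set// inE => TA.
  under eq_expect do rewrite (fE _ _ (Td _ TA)) -big_filter.
  rewrite -[RHS]big_filter; case: (T1 _ TA) => [->|[i ->]].
    under eq_expect do rewrite big_nil.
    by rewrite expect_cst// big_nil.
  under eq_expect do rewrite big_seq1.
  by rewrite big_seq1.
move=> pnaT.
(* Splitting off the constant [k] on both sides leaves [pnaT]. *)
under eq_expect => m.
  rewrite (bigID (fun i => ~~ (U i \in T)))/=.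
  rewrite (eq_bigr (fun i => h i (fun=> 0))); last by move=> i; exact: hcst.
  under [X in (_ * X)]eq_bigl do rewrite negbK.
  rewrite EFinM -/k; over.
rewrite expectZl//; last by move=> m; rewrite lee_fin prodr_ge0.
rewrite [leRHS](bigID (fun i => ~~ (U i \in T)))/=.
rewrite [X in (_ <= X * _)%E](eq_bigr (fun i => (h i (fun=> 0))%:E)); last first.
  move=> i Ui; under eq_expect do rewrite (hcst i _ Ui).
  by rewrite expect_cst.
rewrite prodEFin -/k; under [X in (_ <= _ * X)%E]eq_bigl do rewrite negbK.
by apply: lee_wpmul2l.
Qed.

(** * Traces of a partition *)

Definition trace Y Q : set (set Var) :=
  [set C | C !=set0 /\ exists2 B, Q B & C = B `&` Y].

Lemma trace_partition Y Q : Defs.partition Q -> Defs.partition (trace Y Q).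
Proof.
move=> [_ Qd]; split=> [A []//|_ _ [_ [A QA ->]] [_ [B QB ->]] AB].
rewrite -subset0 => v [[Av Yv] [Bv _]]; apply: AB; congr (_ `&` _).
by apply: contrapT => AB; have : (A `&` B) v by []; rewrite Qd.
Qed.

Lemma trace_sub Y Q : \bigcup_(A in trace Y Q) A `<=` Y.
Proof. by move=> v [_ [_ [B _ ->]] []]. Qed.

(** Each block [B] gets the colour of its trace. Colour classes only grow, so the test functions for
    the traces remain admissible for [Q]. *)
Lemma PNA_trace Y Q d : Defs.partition Q -> PNA Q d -> PNA (trace Y Q) d.
Proof.
move=> Qp Qpna; apply: coloured_PNA_PNA; first exact: trace_partition.
  move=> v [_ [_ [B QB ->]] [Bv _]]; apply: Qpna.1; by exists B.
move=> I s c h us h0 hd hm.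
apply: (PNA_coloured_PNA Qp Qpna (c := fun B => c (B `&` Y))) => // i m m' mm'.
apply: hd => a [_ [[_ [B QB ->]] cB] [Ba Ya]]; apply: mm'; exists B => //.
Qed.

(** * Truncation, and the inclusion of [tensor] in [oplus] *)

Lemma lee_prod_ge0 (I : Type) (s : seq I) (F G : I -> \bar R) :
  (forall i, 0 <= F i)%E -> (forall i, F i <= G i)%E ->
  (\prod_(i <- s) F i <= \prod_(i <- s) G i)%E.
Proof.
move=> F0 FG; elim: s => [|i s IH]; first by rewrite !big_nil.
by rewrite !big_cons lee_pmul// prode_ge0.
Qed.

(** The expectation is a supremum of finite partial sums. Over a finite set [X] of memories all
    values are at most their total [K], so truncating at [K] changes nothing there. *)
Lemma expect_truncate_le d (I : choiceType) (s : seq I)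
    (h : I -> Mem (dom d) -> R) (C : \bar R) :
  (forall i m, 0 <= h i m) ->
  (forall K : R, (0 <= K)%R ->
    expect d (fun m => (\prod_(i <- s) Num.min (h i m) K)%:E) <= C)%E ->
  (expect d (fun m => (\prod_(i <- s) h i m)%:E) <= C)%E.
Proof.
move=> h0 hC; apply: ge_ereal_sup => _ [X [finX _] <-].
pose K := \sum_(m <- fset_set X) \sum_(i <- s) h i m.
have K0 : 0 <= K by rewrite sumr_ge0// => m _; rewrite sumr_ge0.
have hK i m : i \in s -> X m -> h i m <= K.
  move=> si Xm; rewrite /K (big_rem m) ?in_fset_set ?inE//= (big_rem i)//=.
  rewrite -addrA lerDl addr_ge0// sumr_ge0// => j _; by rewrite sumr_ge0.
apply: le_trans (hC K K0); apply: ereal_sup_ubound; exists X; first by split.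
apply: eq_fsbigr => m; rewrite inE => Xm; congr (_ * _%:E)%E.
by apply: eq_big_seq => i si; apply/min_idPl; exact: hK.
Qed.

Lemma expect_bounded_fin d (g : Mem (dom d) -> R) (K : R) : 0 <= K ->
  (forall m, 0 <= g m <= K) -> expect d (fun m => (g m)%:E) \is a fin_num.
Proof.
move=> K0 gK; rewrite ge0_fin_numE; last first.
  by apply: expect_ge0 => m; rewrite lee_fin; case/andP: (gK m).
apply: (@le_lt_trans _ _ K%:E); last exact: ltry.
rewrite -[leRHS](@expect_cst d K)//; apply: le_expect => m.
by rewrite lee_fin; case/andP: (gK m).
Qed.

Lemma partitionU P Q S1 S2 : Defs.partition P -> Defs.partition Q ->
  \bigcup_(A in P) A `<=` S1 -> \bigcup_(A in Q) A `<=` S2 ->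
  S1 `&` S2 = set0 -> Defs.partition (P `|` Q).
Proof.
move=> [P0 Pd] [Q0 Qd] PS1 QS2 S12; split=> [A [/P0|/Q0]//|].
have PQ A B : P A -> Q B -> A `&` B = set0.
  move=> PA QB; rewrite -subset0 -S12 => v [Av Bv].
  by split; [apply: PS1; exists A|apply: QS2; exists B].
move=> A B [PA|QA] [PB|QB] AB; [exact: Pd|exact: PQ|rewrite setIC; exact: PQ|exact: Qd].
Qed.

(** The blocks of [P] lie in [S1], away from [S2], so for fixed [m1] only the blocks of [Q]
    matter. *)
Lemma glue_depends_r S1 S2 D P Q (I : choiceType) (c : set Var -> I) (i : I)
    (h : Mem D -> R) (m1 : Mem S1) :
  \bigcup_(A in P) A `<=` S1 -> S1 `&` S2 = set0 ->
  depends_on (colour_class (P `|` Q) c i) h ->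
  depends_on (colour_class Q c i) (fun m2 : Mem S2 => h (glue D m1 m2)).
Proof.
move=> PS1 S12 hd m2 m2' mm'; apply: hd => a [B [PQB cB] Ba].
rewrite /glue; congr (_ + _).
have [S2a|S2a] := pselect (S2 (sval a)); last by rewrite !restr_out.
rewrite !(restrE _ S2a); case: PQB => [PB|QB]; last by apply: mm'; exists B.
have : (S1 `&` S2) (sval a) by split=> //; apply: PS1; exists B.
by rewrite S12.
Qed.

Lemma glue_depends_l S1 S2 D P Q (I : choiceType) (c : set Var -> I) (i : I)
    (h : Mem D -> R) (m2 : Mem S2) :
  \bigcup_(A in Q) A `<=` S2 -> S1 `&` S2 = set0 ->
  depends_on (colour_class (P `|` Q) c i) h ->
  depends_on (colour_class P c i) (fun m1 : Mem S1 => h (glue D m1 m2)).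
Proof.
rewrite setIC setUC => QS2 S12 hd m1 m1' mm'; rewrite (glueC _ m1) (glueC _ m1').
exact: (glue_depends_r m2 QS2 S12 hd).
Qed.

Lemma tensor_PNA d1 d2 d P Q : tensor d1 d2 d ->
  Defs.partition P -> Defs.partition Q -> PNA P d1 -> PNA Q d2 -> PNA (P `|` Q) d.
Proof.
move=> t12 Pp Qp Ppna Qpna; have [S12 dE _] := t12.
apply: coloured_PNA_PNA.
- exact: partitionU Pp Qp Ppna.1 Qpna.1 S12.
- by rewrite dE bigcup_setU; apply: setUSS; [exact: Ppna.1|exact: Qpna.1].
move=> I s c h0 us h0_ge0 hd0 hm0; apply: expect_truncate_le => // K K0.
(* Truncation keeps sign, monotonicity and dependence, and makes the averages below finite. *)
pose h i m := Num.min (h0 i m) K.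
have h_ge0 i m : 0 <= h i m by rewrite le_min h0_ge0.
have hK i m : 0 <= h i m <= K by rewrite h_ge0 ge_min lexx orbT.
have hd i : depends_on (colour_class (P `|` Q) c i) (h i).
  by move=> m m' mm'; rewrite /h (hd0 _ _ _ mm').
have hm : (forall i, nondecr (h i)) \/ (forall i, nonincr (h i)).
  by case: hm0 => hm0; [left|right] => i m m' mm'; rewrite /h le_min !ge_min hm0//= lexx orbT.
(* Truncated functions have smaller expectations, so the sharper bound by their product suffices. *)
apply: (@le_trans _ _ (\prod_(i <- s) expect d (fun m => (h i m)%:E))%E); last first.
  apply: lee_prod_ge0 => i; first by apply: expect_ge0 => m; rewrite lee_fin.
  by apply: le_expect => m; rewrite lee_fin ge_min lexx.
(* The [d2]-averages of the sections; [g] is their real-valued form, as test functions require. *)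
pose G i (m1 : Mem (dom d1)) := expect d2 (fun m2 => (h i (glue (dom d) m1 m2))%:E).
pose g i (m1 : Mem (dom d1)) := fine (G i m1).
have gE i m1 : (g i m1)%:E = G i m1.
  by rewrite fineK//; apply: expect_bounded_fin K0 _ => m2; exact: hK.
rewrite (expect_tensor t12); last by move=> m; rewrite lee_fin; apply: prodr_ge0 => i _; exact: h_ge0.
(* For each fixed [m1], PNA of [Q] under [d2] bounds the inner expectation by the product of
   averages. *)
apply: (@le_trans _ _ (expect d1 (fun m1 => (\prod_(i <- s) g i m1)%:E))).
  apply: le_expect => m1; rewrite -prodEFin.
  under [leRHS]eq_bigr do rewrite gE.
  apply: (PNA_coloured_PNA Qp Qpna (c := c)
    (h := fun i m2 => h i (glue (dom d) m1 m2))) => //.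
    by move=> i; exact: (glue_depends_r m1 Ppna.1 S12 (hd i)).
  by case: hm => hm; [left|right] => i m m' mm'; apply: hm; exact: glue_le.
have -> : (\prod_(i <- s) expect d (fun m => (h i m)%:E) =
    \prod_(i <- s) expect d1 (fun m => (g i m)%:E))%E.
  apply: eq_bigr => i _; rewrite (expect_tensor t12); last by move=> m; rewrite lee_fin.
  by apply: eq_expect => m1; rewrite gE.
(* PNA of [P] under [d1] applies to the averages, which inherit monotonicity and dependence from the
   sections. *)
apply: (PNA_coloured_PNA Pp Ppna (c := c) (h := g)) => //.
- by move=> i m1; rewrite fine_ge0//; apply: expect_ge0 => m2; rewrite lee_fin.
- move=> i m1 m1' mm'; congr fine; apply: eq_expect => m2; congr EFin.
  exact: (glue_depends_l _ Qpna.1 S12 (hd i)).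
- case: hm => hm; [left|right] => i m m' mm'; rewrite -lee_fin !gE;
    apply: le_expect => m2; rewrite lee_fin; apply: hm; exact: glue_le.
Qed.

Lemma tensor_oplus d1 d2 : tensor d1 d2 `<=` oplus d1 d2.
Proof.
move=> d t12; have [S12 dE _] := t12; split=> //.
- exact: (tensor_le_l t12).2.
- exact: (tensor_le_r t12).2.
- by move=> P Q Pp Qp _ _; exact: tensor_PNA.
Qed.

(** * Frame laws for [oplus] *)

Lemma oplus_le_l d1 d2 d : oplus d1 d2 d -> le_dist d1 d.
Proof. by move=> [_ dE ? _ _]; split=> //; rewrite dE; exact: subsetUl. Qed.

Lemma oplus_le_r d1 d2 d : oplus d1 d2 d -> le_dist d2 d.
Proof. by move=> [_ dE _ ? _]; split=> //; rewrite dE; exact: subsetUr. Qed.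

Lemma oplus_commutative : commutativity (@oplus Var R).
Proof.
move=> x y z [xy0 zE mx my pna]; split=> //; first by rewrite setIC.
  by rewrite setUC.
by move=> P Q Pp Qp PP QQ Ppna Qpna; rewrite setUC; exact: pna.
Qed.

(** PNA moves up from [x'] and [y'] to [x] and [y], is combined in [z], and moves down to the
    marginal of [z]. *)
Lemma oplus_down_closed : down_closed (@le_dist Var R) (@oplus Var R).
Proof.
move=> x y z x' y' oxy x'x y'y; have [S12 zE _ _ pna] := oxy.
have xyz : dom x' `|` dom y' `<=` dom z.
  by rewrite zE; apply: setUSS; [exact: x'x.1|exact: y'y.1].
have mz := marginal_le xyz.
have x'z := le_dist_trans x'x (oplus_le_l oxy).
have y'z := le_dist_trans y'y (oplus_le_r oxy).
exists (marginal xyz) => //; split=> //.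
- by rewrite -subset0 -S12; exact: setISS x'x.1 y'y.1.
- exact: (le_dist_common x'z mz (@subsetUl _ _ _)).2.
- exact: (le_dist_common y'z mz (@subsetUr _ _ _)).2.
move=> P Q Pp Qp Px' Qy' Ppna Qpna; apply/(PNA_le_dist mz).
  by rewrite bigcup_setU; exact: setUSS.
apply: pna => //; first exact: subset_trans Px' x'x.1.
- exact: subset_trans Qy' y'y.1.
- exact/(PNA_le_dist x'x).
- exact/(PNA_le_dist y'y).
Qed.

Lemma oplus_associative : associativity (@oplus Var R).
Proof.
move=> x y z t w otz oxy; have [tz0 wE _ _ tzpna] := otz.
have [xy0 tE _ _ xypna] := oxy.
have yt : dom y `<=` dom t by rewrite tE; exact: subsetUr.
have xt : dom x `<=` dom t by rewrite tE; exact: subsetUl.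
have yzw : dom y `|` dom z `<=` dom w by rewrite wE; exact: setSU.
have tw := oplus_le_l otz; have zw := oplus_le_r otz.
have xw := le_dist_trans (oplus_le_l oxy) tw.
have yw := le_dist_trans (oplus_le_r oxy) tw.
have sw := marginal_le yzw.
have ys := le_dist_common yw sw (@subsetUl _ _ _).
have zs := le_dist_common zw sw (@subsetUr _ _ _).
have xyz0 : dom x `&` (dom y `|` dom z) = set0.
  by rewrite setIUr xy0 set0U -subset0 -tz0; exact: setSI.
exists (marginal yzw); split=> //; [|exact: ys.2|exact: zs.2| | |exact: xw.2|exact: sw.2|].
- by rewrite -subset0 -tz0; exact: setSI.
(* PNA of [P] moves from [y] up to [t], is combined with [Q] in [w], and moves down to the
   marginal. *)
- move=> P Q Pp Qp Py Qz Ppna Qpna; apply/(PNA_le_dist sw).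
    by rewrite bigcup_setU; exact: setUSS.
  apply: tzpna => //; first exact: subset_trans yt.
  by apply/(PNA_le_dist (oplus_le_r oxy)).
- by rewrite wE tE setUA.
(* A block of [Q] may mix variables of [y] and [z], so split [Q] into its traces
   on both domains and recover [P `|` Q] as a coarsening. *)
move=> P Q Pp Qp Px Qs Ppna Qpna.
pose Qy := trace (dom y) Q; pose Qz := trace (dom z) Q.
have Qyp : Defs.partition Qy by exact: trace_partition.
have Qzp : Defs.partition Qz by exact: trace_partition.
have Qypna : PNA Qy y by apply/(PNA_le_dist ys (@trace_sub _ _)); exact: PNA_trace.
have Qzpna : PNA Qz z by apply/(PNA_le_dist zs (@trace_sub _ _)); exact: PNA_trace.
(* First [P] is combined with the traces on [dom y] inside [t], then with the traces on [dom z]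
   inside [w]. *)
have PQy : PNA (P `|` Qy) t by apply: xypna => //; exact: trace_sub.
have PQyt : \bigcup_(A in P `|` Qy) A `<=` dom t by exact: PQy.1.
have : PNA ((P `|` Qy) `|` Qz) w.
  apply: tzpna => //; last exact: trace_sub.
  exact: partitionU Pp Qyp Px (@trace_sub _ _) xy0.
(* Since [Q] is covered by [dom y] and [dom z], each variable of a block lies in one of its
   traces. *)
have tr v A : Q A -> A v ->
    exists B, [/\ (Qy `|` Qz) B, B `<=` A & B v].
  move=> QA Av; have [yv|zv] : (dom y `|` dom z) v by apply: Qs; exists A.
    exists (A `&` dom y); split; [|exact: subIsetl|by []].
    by left; split; [exists v|exists A].
  exists (A `&` dom z); split; [|exact: subIsetl|by []].
  by right; split; [exists v|exists A].
have tr' B : (Qy `|` Qz) B -> exists2 A, Q A & B `<=` A.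
  by move=> [|] [_ [A QA ->]]; exists A => //; exact: subIsetl.
rewrite -setUA; apply: PNA_coarsens; split.
- exact: partitionU Pp Qp Px Qs xyz0.
- rewrite bigcup_setU [RHS]bigcup_setU; congr (_ `|` _); apply/seteqP; split=> v.
    by move=> [A QA Av]; have [B [QB _ Bv]] := tr _ _ QA Av; exists B.
  by move=> [B /tr'[A QA BA] /BA Av]; exists A.
- move=> A [PA|QA].
    exists [set A]; first by move=> _ ->; left.
    by rewrite bigcup_set1.
  (* A block of [Q] is the union of the traces inside it. *)
  exists [set B | (Qy `|` Qz) B /\ B `<=` A]; first by move=> B [QB _]; right.
  apply/seteqP; split=> v; last by move=> [B [_ BA] /BA].
  by move=> Av; have [B [QB BA Bv]] := tr _ _ QA Av; exists B.
Qed.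

(** * The unit and the two frames *)

Lemma unit_dist_sum1 : (\esum_(m in [set: Mem set0]) (1 : R)%:E = 1)%E.
Proof.
rewrite [X in esum X _](_ : _ = [set (fun=> 0) : Mem set0]) ?esum_set1 ?lee_fin//.
by apply/seteqP; split=> // m _; apply/funext => -[].
Qed.

Lemma unit_dist_countable : countable [set m : Mem set0 | (1 : R) != 0].
Proof.
apply: (@sub_countable _ _ _ [set (fun=> 0) : Mem set0]); last exact: countable1.
by apply: subset_card_le => m _; apply/funext => -[].
Qed.

(** The point mass at the empty memory: a unit for [tensor] and, by the inclusion, a witness of Unit
    Existence for [oplus]. *)
Definition unit_dist : dist :=
  Dist (@finite_set0 Var) (fun=> ler01) unit_dist_countable unit_dist_sum1.

Lemma tensor_unit d : tensor unit_dist d d.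
Proof.
split; [by rewrite set0I|by rewrite set0U|].
by move=> m; rewrite mul1r restr_id.
Qed.

Lemma tensor_BI_frame : BI_frame (@le_dist Var R) (@tensor Var R) setT.
Proof.
split; first exact: tensor_down_closed.
split; first by move=> x y z; exact: tensorC.
split; first exact: tensor_associative.
split; first by move=> x; exists unit_dist => //; exact: tensor_unit.
(* With every distribution in [E], Unit Coherence says that a product extends its left factor. *)
by split=> // e x y _; exact: tensor_le_l.
Qed.

Lemma oplus_BI_frame : BI_frame (@le_dist Var R) (@oplus Var R) setT.
Proof.
split; first exact: oplus_down_closed.
split; first exact: oplus_commutative.
split; first exact: oplus_associative.
split; first by move=> x; exists unit_dist => //; apply: tensor_oplus; exact: tensor_unit.
by split=> // e x y _; exact: oplus_le_l.
Qed.

End Distributions.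

Theorem mainTheorem9 (Var : Type) (R : realType) :
  M_BI_frame le_two (@le_dist Var R) (@frame_op Var R)
    (fun _ : two => [set: dist Var R]).
Proof.
split=> [[]|m1 m2 x y [->//|[-> ->]]].
- exact: tensor_BI_frame.
- exact: oplus_BI_frame.
- exact: tensor_oplus.
Qed.
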